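(* Let $K$ be a fractal gasket generated by $\{\varphi_j(z)=r_j(z+d_j)\}_{j=1}^N$, let $r_*=\min_j r_j$, $r^*=\max_j r_j$, $s=\sqrt{\log r^*/\log r_*}$ and $\xi=(r_* )^s$. Then the map $[\mathbf x]\mapsto\pi(\mathbf x)$ from $(\mathcal A_{M_K},\tilde\rho_{M_K,\xi})$ to $K$ (with the Euclidean metric) is a bi-Hölder map with index $s$: it is a bijection and there is $C>0$ with $C^{-1}\tilde\rho_{M_K,\xi}(a,b)^{1/s}\le|\pi(a)-\pi(b)|\le C\,\tilde\rho_{M_K,\xi}(a,b)^s$ for all $a,b\in\mathcal A_{M_K}$.
   Context: Let $\Delta\subset\mathbb R^2$ be the triangle with vertices $\omega_\alpha=(0,0)$, $\omega_\beta=(1,0)$, $\omega_\gamma=(1/2,\sqrt3/2)$. A fractal gasket is the attractor $K$ (nonempty compact with $K=\bigcup_j\varphi_j(K)$) of $\{\varphi_j(z)=r_j(z+d_j)\}_{j=1}^N$, $r_j\in(0,1)$, $d_j\in\mathbb R^2$, such that $\bigcup_j\varphi_j(\Delta)\subset\Delta$ and for $i\ne j$, $\varphi_i(\Delta)\cap\varphi_j(\Delta)$ consists only of common vertices. Let $\Sigma=\{1,\dots,N\}$. Set $\alpha=-1$ if $(0,0)\notin K$, otherwise $\alpha$ is the index with $\varphi_\alpha((0,0))=(0,0)$; similarly $\beta=-2$ or $\varphi_\beta$ fixes $(1,0)$; $\gamma=-3$ or $\varphi_\gamma$ fixes $\omega_\gamma$. The coding map $\pi:\Sigma^\infty\to K$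 is $\{\pi(\mathbf x)\}=\bigcap_{i\ge1}\varphi_{x_1}\circ\cdots\circ\varphi_{x_i}(K)$. $\Sigma$-automaton, itinerary, surviving time: a $\Sigma$-automaton has states $Q_0\cup\{Id,Exit\}$, input alphabet $\Sigma^2$, initial state $Id$, transition $\delta$ with $\delta(Id,(i,j))=Id$ iff $i=j$; itinerary $S_0=Id$, $S_k=\delta(S_{k-1},(x_k,y_k))$ stopped at $Exit$; $T_M(\mathbf x,\mathbf y)$ = largest $k$ with $S_k\ne Exit$ (possibly $\infty$); $\rho_{M,\xi}=\xi^{T_M}$ ($\xi^\infty=0$). Triangle automaton: states $S_{uv}$ ($u\neq v\in\{\alpha,\beta,\gamma\}$) plus $Id,Exit$; $\delta(Id,(i,j))=S_{uv}\Rightarrow\delta(Id,(j,i))=S_{vu}$; $\delta(S_{uv},(i,j))=S_{uv}$ if $(i,j)=(v,u)$, else $Exit$. The topology automaton $M_K$ is the triangle automaton with, for $i\neq j$: $\delta(Id,(i,j))=S_{uv}$ if $u,v\in\Sigma$ and $\varphi_i(\omega_v)=\varphi_j(\omega_u)$, and $\delta(Id,(i,j))=Exit$ if $\varphi_i(K)\cap\varphi_j(K)=\emptyset$. With $\mathbf x\sim\mathbf y$ iff $\rho_{M_K,\xi}(\mathbf x,\mathbf y)=0$, $\mathcal A_{M_K}=\Sigma^\infty/\sim$ and $\tilde\rho_{M_K,\xi}([\mathbf x],[\mathbf y])=\inf\{\rho_{M_K,\xi}(\mathbf a,\mathbf b):\mathbf a\in[\mathbf x],\mathbf b\in[\mathbf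 y]\}$. *)

(* Defs.v *)
From HB Require Import structures.
From mathcomp Require Import all_boot all_order all_algebra.
From mathcomp Require Import all_classical all_reals all_analysis.
Set Implicit Arguments. Unset Strict Implicit. Unset Printing Implicit Defensive.
Import Order.TTheory GRing.Theory Num.Theory.
Import numFieldTopology.Exports numFieldNormedType.Exports.
Local Open Scope classical_set_scope.
Local Open Scope ring_scope.

Section Gasket.
Variable R : realType.

Definition omega (u : 'I_3) : R * R :=
  if val u == 0%N then (0, 0)
  else if val u == 1%N then (1, 0)
  else (2^-1, Num.sqrt 3 / 2).

(* The closed (filled) triangle Delta = convex hull of the three vertices:
   p = a*(0,0) + b*(1,0) + c*(1/2, sqrt3/2). *)
Definition Delta : set (R * R) :=
  [set p | exists a b c : R, [/\ 0 <= a, 0 <= b, 0 <= c, a + b + c = 1 &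
     p = (b * 1 + c * 2^-1, c * (Num.sqrt 3 / 2))]].

Definition eucl_dist (p q : R * R) : R :=
  Num.sqrt ((p.1 - q.1) ^+ 2 + (p.2 - q.2) ^+ 2).

Variables (N : nat) (r : 'I_N -> R) (d : 'I_N -> R * R).

Definition phi (j : 'I_N) (z : R * R) : R * R :=
  (r j * (z.1 + (d j).1), r j * (z.2 + (d j).2)).

Definition gasket (K : set (R * R)) : Prop :=
  [/\ (forall j, 0 < r j < 1),
      (forall j, phi j @` Delta `<=` Delta),
      (forall i j, i != j -> forall p, (phi i @` Delta) p -> (phi j @` Delta) p ->
          exists u v : 'I_3, p = phi i (omega u) /\ p = phi j (omega v)),
      ((exists p, K p) /\ compact K) &
      K = \bigcup_(j in setT) (phi j @` K)].

Variable K : set (R * R).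

(* phi_{x_1} o ... o phi_{x_n}; sequences are 0-indexed: x_k := x (k-1). *)
Fixpoint phicomp (x : nat -> 'I_N) (n : nat) (z : R * R) : R * R :=
  match n with
  | 0%N => z
  | n'.+1 => phi (x 0%N) (phicomp (fun k => x k.+1) n' z)
  end.

(* coding map: pi(x) is the (unique) point of the intersection. *)
Definition piK (x : nat -> 'I_N) : R * R :=
  xget (0, 0) (\bigcap_(n in setT) (phicomp x n @` K)).

Definition state := option (option ('I_3 * 'I_3)).
Definition st_Exit : state := None.
Definition st_Id : state := Some None.
Definition st_S (u v : 'I_3) : state := Some (Some (u, v)).

(* "phi_j fixes the vertex omega_u", i.e. j is the index alpha/beta/gamma
   attached to the label u; "u in Sigma" iff some phi_j fixes omega_u. *)
Definition fixes (j : 'I_N) (u : 'I_3) : Prop := phi j (omega u) = omega u.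
Definition inSigma (u : 'I_3) : Prop := exists j, fixes j u.

Definition delta (s : state) (i j : 'I_N) : state :=
  match s with
  | None => st_Exit
  | Some None =>
      if i == j then st_Id else
      match [pick uv : 'I_3 * 'I_3 |
               `[< uv.1 != uv.2 /\ inSigma uv.1 /\ inSigma uv.2 /\
                   phi i (omega uv.2) = phi j (omega uv.1) >] ] with
      | Some uv => st_S uv.1 uv.2
      | None => st_Exit  (* then phi_i(K) and phi_j(K) are disjoint *)
      end
  | Some (Some (u, v)) =>
      if `[< fixes i v /\ fixes j u >] then st_S u v else st_Exit
  end.

Fixpoint itin (x y : nat -> 'I_N) (k : nat) : state :=
  match k with
  | 0%N => st_Id
  | k'.+1 => delta (itin x y k') (x k') (y k')
  end.

(* rho_{M,xi}(x,y) = xi ^ T(x,y), where T is the largest k with S_k <> Exit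
   (= first exit time minus one, Exit being absorbing), and xi^oo = 0. *)
Definition rhoM (xi : R) (x y : nat -> 'I_N) : R :=
  match pselect (exists k, (fun k => itin x y k == st_Exit) k) with
  | left h => xi ^+ (ex_minn h).-1
  | right _ => 0
  end.

Definition simM (xi : R) (x y : nat -> 'I_N) : Prop := rhoM xi x y = 0.

Definition rhoT (xi : R) (x y : nat -> 'I_N) : R :=
  inf [set t | exists a b, [/\ simM xi x a, simM xi y b & t = rhoM xi a b]].

End Gasket.

(* Main.v *)
(* In barycentric coordinates every map of the system reads
   [z |-> r z + t] with [t >= 0], which gives [K <= Delta] and turns the geometry
   of touching triangles into linear inequalities.  While the itinerary of (x, y)
   is alive after k steps, pi(x) and pi(y) lie within a constant times rmax^k of
   a common point; as soon as it dies at step k+1, either the two cells are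
   disjoint (at a uniform relative distance, by compactness), or one of the two
   points is at distance at least a constant times rmin^k from the common vertex
   of two triangles that lie on opposite sides of a line through that vertex.
   With T the surviving time this gives
   c rmin^T <= |pi(x) - pi(y)| <= C rmax^T for all representatives, and the choice
   of s makes rho^s = rmax^T and rho^(1/s) = rmin^T. *)
Require Import Defs.
From mathcomp Require Import all_boot all_order all_algebra.
From mathcomp Require Import all_classical all_reals all_analysis.
From mathcomp Require Import ring lra.
Import Order.TTheory GRing.Theory Num.Theory.
Import numFieldTopology.Exports numFieldNormedType.Exports.
Local Open Scope classical_set_scope.
Local Open Scope ring_scope.

Set Implicit Arguments.
Unset Strict Implicit.
Unset Printing Implicit Defensive.

(** * Positive lower bounds over finite families and geometric decay *)

Lemma finite_pos_lb (R : realType) (I : finType) (P : I -> Prop) (f : I -> R) :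
  (forall i, P i -> 0 < f i) ->
  exists c, 0 < c /\ forall i, P i -> c <= f i.
Proof.
(* Starting the minimum at 1 keeps the bound positive when no index satisfies [P]. *)
move=> f0; exists (\big[Num.min/1]_(i | `[< P i >]) f i); split.
  by apply: lt_bigmin => // i /asboolP /f0.
by move=> i Pi; apply: bigmin_le_cond; apply/asboolP.
Qed.

Lemma le_geometric_le0 (R : realType) (a C q : R) :
  0 <= q < 1 -> (forall n, a <= C * q ^+ n) -> a <= 0.
Proof.
move=> /andP[q0 q1] H.
have qlt : `|q| < 1 by rewrite ger0_norm.
have cv := @cvg_geometric R C q qlt.
rewrite -(cvg_lim (@Rhausdorff R) cv).
apply: limr_ge; first by apply/cvg_ex; exists 0.
by near=> n; exact: H.
Unshelve. all: by end_near. Qed.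

(** * Barycentric coordinates and the l1 distance on the triangle *)

Section Barycentric.
Variable R : realType.
Implicit Types p q z : R * R.

(** The affine function equal to 1 at vertex [u] and 0 at the other two vertices. *)
Definition bary (u : 'I_3) z : R :=
  if val u == 0%N then 1 - z.1 - z.2 / Num.sqrt 3
  else if val u == 1%N then z.1 - z.2 / Num.sqrt 3
  else z.2 * (2 / Num.sqrt 3).

(** The l1 distance: it scales exactly under each map, avoids square roots, and is within a factor 2
    of the Euclidean one. *)
Definition dist1 p q : R := `|p.1 - q.1| + `|p.2 - q.2|.

Lemma sqrt3_gt1 : 1 < Num.sqrt 3 :> R.
Proof. by rewrite -[ltLHS]sqrtr1 ltr_sqrt; lra. Qed.

Lemma sqrt3_neq0 : Num.sqrt 3 != 0 :> R.
Proof. by have := sqrt3_gt1; case: eqP => // ->; lra. Qed.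

Lemma sum_bary z :
  bary ord0 z + bary (inord 1) z + bary (inord 2) z = 1.
Proof. by rewrite /bary /= !inordK //=; field; exact: sqrt3_neq0. Qed.

Lemma ord3_ind (P : 'I_3 -> Prop) :
  P ord0 -> P (inord 1) -> P (inord 2) -> forall u, P u.
Proof.
move=> P0 P1 P2 [[|[|[|//]]] Hu].
- by have -> : Ordinal Hu = ord0 by exact/val_inj.
- by have -> : Ordinal Hu = inord 1 by apply/val_inj; rewrite /= inordK.
- by have -> : Ordinal Hu = inord 2 by apply/val_inj; rewrite /= inordK.
Qed.

Lemma bary_omega u v : bary u (omega R v) = (u == v)%:R.
Proof.
have s0 := sqrt3_neq0; rewrite -val_eqE.
elim/ord3_ind: u; elim/ord3_ind: v; rewrite /bary /omega /= ?inordK //=; field => //.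
Qed.

Lemma baryE z :
  z = (bary (inord 1) z + bary (inord 2) z / 2, bary (inord 2) z * (Num.sqrt 3 / 2)).
Proof.
have s0 := sqrt3_neq0; rewrite [LHS]surjective_pairing /bary /= !inordK //=.
by congr pair; field.
Qed.

(** The coordinates sum to 1, so the remaining one is 1, and a point is determined by its
    coordinates. *)
Lemma eq_omega u z : (forall w, w != u -> bary w z = 0) -> z = omega R u.
Proof.
move=> H; have S := sum_bary z.
have H' w : bary w z = bary w (omega R u).
  rewrite bary_omega; case: eqVneq => [->{w}|/H //].
  move: S H.
  elim/ord3_ind: u => S H.
  - by move: S; rewrite (H (inord 1)) ?(H (inord 2)) ?addr0 // -val_eqE /= inordK.
  - by move: S; rewrite (H ord0) ?(H (inord 2)) ?addr0 ?add0r // -val_eqE /= !inordK.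
  - by move: S; rewrite (H ord0) ?(H (inord 1)) ?addr0 ?add0r // -val_eqE /= !inordK.
by rewrite (baryE z) !H' -baryE.
Qed.

Lemma DeltaP z : @Delta R z <-> forall u, 0 <= bary u z.
Proof.
have s0 := sqrt3_neq0; split=> [[a [b [c [a0 b0 c0 abc ->]]]]|H].
  elim/ord3_ind; rewrite /bary /= ?inordK //=.
  - have -> // : 1 - (b * 1 + c / 2) - c * (Num.sqrt 3 / 2) / Num.sqrt 3 = a.
    rewrite (_ : a = 1 - b - c); [by field|lra].
  - by have -> // : b * 1 + c / 2 - c * (Num.sqrt 3 / 2) / Num.sqrt 3 = b by field.
  - by have -> // : c * (Num.sqrt 3 / 2) * (2 / Num.sqrt 3) = c by field.
exists (bary ord0 z), (bary (inord 1) z), (bary (inord 2) z); split => //.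
  exact: sum_bary.
by rewrite mulr1 -baryE.
Qed.

Lemma bary_le1 u z : @Delta R z -> bary u z <= 1.
Proof.
move=> /DeltaP H; have := sum_bary z.
have := H ord0; have := H (inord 1); have := H (inord 2).
by elim/ord3_ind: u => *; lra.
Qed.

Lemma Delta_omega u : @Delta R (omega R u).
Proof. by apply/DeltaP => v; rewrite bary_omega. Qed.

Lemma sqrt3V_gt0_lt1 : 0 < (Num.sqrt 3 : R)^-1 < 1.
Proof.
have := sqrt3_gt1 => s1; apply/andP; split; first by rewrite invr_gt0; lra.
by rewrite invf_lt1 //; lra.
Qed.

(** The coefficients of the three affine functions are at most 2 in absolute value, because
    [1 / sqrt 3 < 1]. *)
Lemma bary_lip u p q : bary u p - bary u q <= 2 * dist1 p q.
Proof.
have /andP[k0 k1] := sqrt3V_gt0_lt1; rewrite /dist1 /bary.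
move: (Num.sqrt 3)^-1 k0 k1 => k k0 k1.
set a := p.1 - q.1; set b := p.2 - q.2.
have := ler_norm a; have := ler_norm (- a); rewrite normrN => a1 a2.
have [b1 b2] : `|k * b| <= `|b| /\ `|k * b| <= `|b|.
  by split; rewrite normrM gtr0_norm // ler_piMl // ltW.
have := ler_norm (k * b); have := ler_norm (- (k * b)); rewrite normrN => b3 b4.
have E1 : k * b = k * p.2 - k * q.2 by rewrite /b mulrBr.
have E2 : a = p.1 - q.1 by [].
by case: ifP => _; [|case: ifP => _]; lra.
Qed.

Lemma dist1C p q : dist1 p q = dist1 q p.
Proof. by rewrite /dist1 distrC [X in _ + X]distrC. Qed.

Lemma dist1_ge0 p q : 0 <= dist1 p q.
Proof. exact: addr_ge0. Qed.

Lemma dist1_triangle p q z : dist1 p q <= dist1 p z + dist1 z q.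
Proof.
rewrite /dist1; have := ler_distD z.1 p.1 q.1; have := ler_distD z.2 p.2 q.2; lra.
Qed.

Lemma dist1_le0 p q : dist1 p q <= 0 -> p = q.
Proof.
rewrite /dist1 => H.
have a0 := normr_ge0 (p.1 - q.1); have b0 := normr_ge0 (p.2 - q.2).
have /normr0_eq0/eqP : `|p.1 - q.1| = 0 by lra.
have /normr0_eq0/eqP : `|p.2 - q.2| = 0 by lra.
rewrite !subr_eq0 => /eqP E2 /eqP E1.
by rewrite [p]surjective_pairing [q]surjective_pairing E1 E2.
Qed.

Lemma eucl_le_dist1 p q : eucl_dist p q <= dist1 p q.
Proof.
rewrite /eucl_dist -[leRHS]ger0_norm ?dist1_ge0 // -sqrtr_sqr ler_wsqrtr //.
rewrite /dist1 [leRHS]sqrrD !real_normK ?num_real // -addrA lerD2l addrC lerDl.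
by rewrite mulrn_wge0 ?mulr_ge0.
Qed.

Lemma dist1_le_eucl p q : dist1 p q <= 2 * eucl_dist p q.
Proof.
rewrite /dist1 /eucl_dist.
have H1 : `|p.1 - q.1| <= Num.sqrt ((p.1 - q.1) ^+ 2 + (p.2 - q.2) ^+ 2).
  by rewrite -sqrtr_sqr ler_wsqrtr // lerDl sqr_ge0.
have H2 : `|p.2 - q.2| <= Num.sqrt ((p.1 - q.1) ^+ 2 + (p.2 - q.2) ^+ 2).
  by rewrite -sqrtr_sqr ler_wsqrtr // lerDr sqr_ge0.
lra.
Qed.

Lemma dist1_Delta p q : @Delta R p -> @Delta R q -> dist1 p q <= 2.
Proof.
move=> pD qD.
(* The height [sqrt 3 / 2] is at most 1, so the triangle lies in the unit square, whose l1 diameter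
   is 2. *)
have s2 : Num.sqrt 3 <= 2 :> R.
  have -> : 2 = Num.sqrt (2 ^+ 2) :> R by rewrite sqrtr_sqr ger0_norm.
  by rewrite ler_wsqrtr //; lra.
have s1 := sqrt3_gt1.
have in01 z : @Delta R z -> 0 <= z.1 <= 1 /\ 0 <= z.2 <= 1.
  move=> zD; have := sum_bary z; have /DeltaP H := zD.
  have := H ord0; have := H (inord 1); have := H (inord 2).
  have := bary_le1 (inord 2) zD.
  have := congr1 fst (baryE z); have := congr1 snd (baryE z) => /= -> -> c1 c0 b0 a0 S.
  split; apply/andP; split; [lra|lra|by rewrite mulr_ge0 //; lra|].
  by rewrite mulr_ile1 //; lra.
have [/andP[? ?] /andP[? ?]] := in01 _ pD.
have [/andP[? ?] /andP[? ?]] := in01 _ qD.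
have : `|p.1 - q.1| <= 1 by rewrite ler_norml; apply/andP; split; lra.
have : `|p.2 - q.2| <= 1 by rewrite ler_norml; apply/andP; split; lra.
rewrite /dist1; lra.
Qed.

Lemma continuous_affine (a b c : R) :
  continuous (fun z : R * R => a * z.1 + b * z.2 + c).
Proof.
move=> z.
have h1 : (fun z : R * R => a * z.1) @ z --> a * z.1.
  by apply: cvgMr; exact: cvg_fst.
have h2 : (fun z : R * R => b * z.2) @ z --> b * z.2.
  by apply: cvgMr; exact: cvg_snd.
exact: cvgD (cvgD h1 h2) (cvg_cst c).
Qed.

Lemma continuous_bary u : continuous (bary u).
Proof.
pose k := (Num.sqrt 3 : R)^-1.
elim/ord3_ind: u.
- rewrite (_ : bary _ = fun z => (-1) * z.1 + (- k) * z.2 + 1).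
    exact: continuous_affine.
  by apply/funext => z; rewrite /bary /= /k; ring.
- rewrite (_ : bary _ = fun z => 1 * z.1 + (- k) * z.2 + 0).
    exact: continuous_affine.
  by apply/funext => z; rewrite /bary /= inordK //= /k; ring.
- rewrite (_ : bary _ = fun z => 0 * z.1 + (2 * k) * z.2 + 0).
    exact: continuous_affine.
  by apply/funext => z; rewrite /bary /= inordK //= /k; ring.
Qed.

Definition conv2 (c : R) p q : R * R :=
  ((1 - c) * p.1 + c * q.1, (1 - c) * p.2 + c * q.2).

Lemma bary_conv2 u c p q :
  bary u (conv2 c p q) = (1 - c) * bary u p + c * bary u q.
Proof. by rewrite /bary /conv2 /=; case: ifP => _; [|case: ifP => _]; ring. Qed.

Lemma Delta_conv2 c p q :
  0 <= c <= 1 -> @Delta R p -> @Delta R q -> @Delta R (conv2 c p q).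
Proof.
move=> /andP[c0 c1] /DeltaP pD /DeltaP qD; apply/DeltaP => u.
by rewrite bary_conv2 addr_ge0 ?mulr_ge0 ?subr_ge0.
Qed.

End Barycentric.

(** * Geometry of the cells: fixed vertices, touching corners, first transition *)

Section GasketGeometry.
Variables (R : realType) (N : nat) (r : 'I_N -> R) (d : 'I_N -> R * R).
Variables (K : set (R * R)).
Hypothesis gK : gasket r d K.

Local Notation f := (phi r d).
Local Notation Dl := (@Delta R).
Local Notation om := (omega R).

(** The constant term of the map in the coordinate [u]: [bary u] is sent to
    [r j * bary u + bary_shift u j]. *)
Definition bary_shift u j : R := bary u (f j (0, 0)) - r j * bary u (0, 0).

Lemma ratio_gt0 j : 0 < r j.
Proof. by case: gK => /(_ j)/andP[]. Qed.

Lemma ratio_lt1 j : r j < 1.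
Proof. by case: gK => /(_ j)/andP[]. Qed.

Lemma phi_inj j : injective (f j).
Proof.
move=> [a b] [a' b'] [/(mulfI (lt0r_neq0 (ratio_gt0 j)))/addIr ->].
by move=> /(mulfI (lt0r_neq0 (ratio_gt0 j)))/addIr ->.
Qed.

Lemma phi_Delta j z : Dl z -> Dl (f j z).
Proof. by move=> zD; case: gK => _ /(_ j) + _ _ _; apply; exists z. Qed.

Lemma bary_phi u j z : bary u (f j z) = r j * bary u z + bary_shift u j.
Proof.
rewrite /bary_shift /bary /phi /=; case: ifP => _; [|case: ifP => _]; ring.
Qed.

Lemma neq_vertex (u : 'I_3) : exists w : 'I_3, w != u.
Proof.
by elim/ord3_ind: u; [exists (inord 1)|exists ord0|exists ord0];
  rewrite -val_eqE /= inordK.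
Qed.

(** The shift is the [u]-coordinate of the image of a vertex other than [u], and that image lies in
    the triangle. *)
Lemma bary_shift_ge0 u j : 0 <= bary_shift u j.
Proof.
have [w wu] := neq_vertex u.
have /DeltaP/(_ u) := phi_Delta j (Delta_omega R w).
by rewrite bary_phi bary_omega eq_sym (negbTE wu) mulr0 add0r.
Qed.

Lemma sum_bary_shift j :
  bary_shift ord0 j + bary_shift (inord 1) j + bary_shift (inord 2) j = 1 - r j.
Proof.
have := sum_bary (f j (0, 0)); have := sum_bary ((0, 0) : R * R).
rewrite !bary_phi; move: (bary _ _) (bary _ _) (bary _ _) => c b a S0 S1.
have : r j * (a + b + c) = r j by rewrite S0 mulr1.
by rewrite !mulrDr => E; lra.
Qed.

Lemma bary_shiftD u w j : u != w -> bary_shift u j + bary_shift w j <= 1 - r j.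
Proof.
have := sum_bary_shift j.
have := bary_shift_ge0 ord0 j; have := bary_shift_ge0 (inord 1) j.
have := bary_shift_ge0 (inord 2) j.
by elim/ord3_ind: u; elim/ord3_ind: w; rewrite ?eqxx // => *; lra.
Qed.

Lemma bary_shift_le u j : bary_shift u j <= 1 - r j.
Proof.
have [w] := neq_vertex u; rewrite eq_sym => /(bary_shiftD j).
by have := bary_shift_ge0 w j; lra.
Qed.

(** Each coordinate [w != u] of the image is a sum of two nonnegative terms equal to 0, so both
    vanish: one locates [z], the other shows that the vertex is fixed. *)
Lemma phi_eq_omega j u z : Dl z -> f j z = om u -> z = om u /\ fixes r d j u.
Proof.
move=> /DeltaP zD E.
have H w : w != u -> r j * bary w z = 0 /\ bary_shift w j = 0.
  move=> wu; have := bary_phi w j z; rewrite E bary_omega (negbTE wu) /=.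
  by have := bary_shift_ge0 w j; have := mulr_ge0 (ltW (ratio_gt0 j)) (zD w); split; lra.
have zE : z = om u.
  apply: eq_omega => w /H[/eqP + _].
  by rewrite mulf_eq0 (gt_eqF (ratio_gt0 j)) => /eqP.
by split => //; rewrite /fixes -[in f j _]zE.
Qed.

(** The quantity is [1 - bary u] at the image of vertex [u]. If it were 0, the other two shifts
    would vanish and the vertex would be fixed. *)
Lemma nfixes_defect j u : ~ fixes r d j u -> 0 < 1 - r j - bary_shift u j.
Proof.
move=> nf; rewrite lt_neqAle subr_ge0 bary_shift_le andbT.
apply/eqP => E; apply: nf; apply: eq_omega => w wu.
rewrite bary_phi bary_omega (negbTE wu) mulr0 add0r.
have := bary_shiftD j wu; have := bary_shift_ge0 w j; lra.
Qed.

Lemma dist1_phi j p q : dist1 (f j p) (f j q) = r j * dist1 p q.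
Proof.
rewrite /dist1 /phi /= -!mulrBr !normrM (gtr0_norm (ratio_gt0 j)) -mulrDr.
by rewrite !opprD !addrA !(addrAC _ _ (- q.1)) !(addrAC _ _ (- q.2)) !addrK.
Qed.

(* Seen from the common vertex, the two triangles lie on opposite sides of the
   level line of [bary v], so [bary v] separates them linearly. *)
Lemma touching_dist i j u v p q :
    u != v -> f i (om v) = f j (om u) -> Dl p -> Dl q ->
  r i * (1 - bary v p) <= 2 * dist1 (f i p) (f j q).
Proof.
move=> uv E pD /DeltaP/(_ v) qD; rewrite dist1C.
apply: le_trans (bary_lip v _ _).
have := congr1 (bary v) E; rewrite !bary_phi !bary_omega eqxx eq_sym (negbTE uv) /=.
by have := mulr_ge0 (ltW (ratio_gt0 j)) qD; lra.
Qed.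

Lemma touching_vertices i j p q :
    i != j -> Dl p -> Dl q -> f i p = f j q ->
  exists u v, p = om u /\ q = om v.
Proof.
move=> ij pD qD E; case: gK => _ _ /(_ i j ij (f i p)) + _ _.
case; [by exists p|by exists q|].
move=> u [v [/phi_inj Ep Ej]]; exists u, v; split=> //.
by apply: (@phi_inj j); rewrite -Ej -E.
Qed.

Lemma half_not_vertex u v w : u != v -> conv2 2^-1 (om u) (om v) <> om w.
Proof.
move=> uv /(congr1 (bary u)); rewrite bary_conv2 !bary_omega eqxx (negbTE uv) /=.
by case: (u == w) => /=; lra.
Qed.

(** Around a point [a] with a common image, the two maps differ only by their ratios, so rescaling
    by [r i / r j] about [a] converts one into the other. *)
Lemma phi_conv2 i j a m :
  f i a = f j a -> f i m = f j (conv2 (r i / r j) a m).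
Proof.
case: a m => [a1 a2] [m1 m2]; rewrite /phi /conv2 /= => -[E1 E2].
have j0 := lt0r_neq0 (ratio_gt0 j).
congr pair.
  transitivity (r i * (a1 + (d i).1) + r i * (m1 - a1)); first by ring.
  by rewrite E1; field.
transitivity (r i * (a2 + (d i).2) + r i * (m2 - a2)); first by ring.
by rewrite E2; field.
Qed.

(* If both triangles had their v-corner at the same point, the smaller one
   would be contained in the larger one. *)
Lemma same_corner_aux i j v :
  i != j -> r i <= r j -> f i (om v) <> f j (om v).
Proof.
move=> ij rij E; have [w wv] := neq_vertex v.
(* The midpoint of a side at the corner [v] is not a vertex, yet its image under [f i] also lies in
   the image of the triangle under [f j]. *)
pose m := conv2 2^-1 (om v) (om w).
have mD : Dl m by apply: Delta_conv2; [lra|exact: Delta_omega|exact: Delta_omega].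
pose q := conv2 (r i / r j) (om v) m.
have i0 := ratio_gt0 i; have j0 := ratio_gt0 j.
have qD : Dl q.
  apply: Delta_conv2 => //; last exact: Delta_omega.
  apply/andP; split; first by rewrite divr_ge0 // ltW.
  by rewrite ler_pdivrMr // mul1r.
have Eq : f i m = f j q by exact: phi_conv2.
have [u [_ [mE _]]] := touching_vertices ij mD qD Eq.
by apply: half_not_vertex mE; rewrite eq_sym.
Qed.

Lemma same_corner i j v : i != j -> f i (om v) <> f j (om v).
Proof.
move=> ij; case: (leP (r i) (r j)) => [/same_corner_aux|/ltW/same_corner_aux H].
  exact.
by move/esym; apply: H; rewrite eq_sym.
Qed.

Lemma K_selfsim p : K p <-> exists j q, K q /\ p = f j q.
Proof.
case: gK => _ _ _ _ KE; split.
  by rewrite {1}KE => -[j _ [q Kq <-]]; exists j, q.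
by case=> j [q [Kq ->]]; rewrite KE; exists j => //; exists q.
Qed.

Lemma K_phi j q : K q -> K (f j q).
Proof. by move=> Kq; apply/K_selfsim; exists j, q. Qed.

(** At a point of [K] minimizing [bary u], self-similarity gives [min >= r j * min + t] with
    [t >= 0] and [r j < 1], hence [min >= 0]. *)
Lemma K_Delta p : K p -> Dl p.
Proof.
move=> Kp; apply/DeltaP => u; case: gK => _ _ _ [[p0 Kp0] cK] _.
have K0 : K !=set0 by exists p0.
have [c cin cmin] :=
  compact_EVT_min K0 cK (continuous_subspaceT (@continuous_bary R u)).
apply: le_trans (cmin p (mem_set Kp)).
move/set_mem/K_selfsim: cin => [j [q [Kq E]]].
have := cmin q (mem_set Kq); rewrite E bary_phi.
have := bary_shift_ge0 u j; have := ratio_gt0 j; have := ratio_lt1 j.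
by move: (bary u q) (bary_shift u j) (r j) => b t x *; nra.
Qed.

Lemma omega_K_inSigma u : K (om u) -> inSigma r d u.
Proof.
move=> /K_selfsim[j [q [Kq E]]]; exists j.
by case: (phi_eq_omega (K_Delta Kq) (esym E)).
Qed.

Local Notation dl := (delta r d).

(** Justifies the default [Exit] of [delta]: cells that meet share a vertex, its two labels differ
    by [same_corner], and both vertices lie in [K], hence are fixed by some map. *)
Lemma delta_Id i j : i != j ->
  (exists u v, [/\ u != v, f i (om v) = f j (om u) & dl (@st_Id) i j = st_S u v])
  \/ (dl (@st_Id) i j = st_Exit /\ forall p q, K p -> K q -> f i p <> f j q).
Proof.
move=> ij; rewrite /delta /= (negbTE ij).
case: pickP => [[u v] /asboolP[/= uv [_ [_ E]]]|H]; first by left; exists u, v.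
right; split=> // p q Kp Kq E.
have [v [u [pE qE]]] := touching_vertices ij (K_Delta Kp) (K_Delta Kq) E.
have uv : u != v.
  by apply/eqP => uv; move: E; rewrite pE qE uv; exact: same_corner.
have /negP := H (u, v); apply; apply/asboolP; split=> //=.
by rewrite pE qE in Kp Kq E *; split; [|split] => //; apply: omega_K_inSigma.
Qed.

End GasketGeometry.

(** * Uniform separation of disjoint cells, and the coding map *)

Section Coding.
Variables (R : realType) (N : nat) (r : 'I_N -> R) (d : 'I_N -> R * R).
Variables (K : set (R * R)) (lo hi : R).
Hypothesis gK : gasket r d K.
Hypotheses (lo_gt0 : 0 < lo) (hi_lt1 : hi < 1).
Hypotheses (lo_le : forall j, lo <= r j) (le_hi : forall j, r j <= hi).
Implicit Types x y : nat -> 'I_N.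

Local Notation f := (phi r d).
Local Notation om := (omega R).
Local Notation tl x := (fun k => x k.+1).
Local Notation code := (piK r d K).
Local Notation it := (itin r d).

Lemma continuous_phi j : continuous (f j).
Proof.
move=> z; rewrite /phi.
have h1 : (fun z : R * R => r j * (z.1 + (d j).1)) @ z --> r j * (z.1 + (d j).1).
  rewrite (_ : (fun z : R * R => _) = fun z => r j * z.1 + 0 * z.2 + r j * (d j).1).
    have -> : r j * (z.1 + (d j).1) = r j * z.1 + 0 * z.2 + r j * (d j).1 by ring.
    exact: continuous_affine.
  by apply/funext => t; ring.
have h2 : (fun z : R * R => r j * (z.2 + (d j).2)) @ z --> r j * (z.2 + (d j).2).
  rewrite (_ : (fun z : R * R => _) = fun z => 0 * z.1 + r j * z.2 + r j * (d j).2).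
    have -> : r j * (z.2 + (d j).2) = 0 * z.1 + r j * z.2 + r j * (d j).2 by ring.
    exact: continuous_affine.
  by apply/funext => t; ring.
exact: cvg_pair h1 h2.
Qed.

Lemma continuous_dist1_phi i j :
  continuous (fun z : (R * R) * (R * R) => dist1 (f i z.1) (f j z.2)).
Proof.
move=> z.
have h1 : (fun z : (R * R) * (R * R) => f i z.1) @ z --> f i z.1.
  have c1 : fst @ z --> z.1 by exact: cvg_fst.
  exact: (cvg_comp _ _ c1 (@continuous_phi i z.1)).
have h2 : (fun z : (R * R) * (R * R) => f j z.2) @ z --> f j z.2.
  have c2 : snd @ z --> z.2 by exact: cvg_snd.
  exact: (cvg_comp _ _ c2 (@continuous_phi j z.2)).
have p1 (w : R * R) : fst @ w --> w.1 by exact: cvg_fst.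
have p2 (w : R * R) : snd @ w --> w.2 by exact: cvg_snd.
have h11 := cvg_comp _ _ h1 (p1 _); have h12 := cvg_comp _ _ h1 (p2 _).
have h21 := cvg_comp _ _ h2 (p1 _); have h22 := cvg_comp _ _ h2 (p2 _).
exact: cvgD (cvg_norm (cvgB h11 h21)) (cvg_norm (cvgB h12 h22)).
Qed.

Lemma disjoint_dist i j :
    (forall p q, K p -> K q -> f i p <> f j q) ->
  exists c, 0 < c /\ forall p q, K p -> K q -> c <= dist1 (f i p) (f j q).
Proof.
move=> H; case: (gK) => _ _ _ [[p0 Kp0] cK] _.
have KK0 : K `*` K !=set0 by exists (p0, p0).
have [z /set_mem[/= Kz1 Kz2] zmin] := compact_EVT_min KK0 (compact_setX cK cK)
  (continuous_subspaceT (@continuous_dist1_phi i j)).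
exists (dist1 (f i z.1) (f j z.2)); split.
  by rewrite ltNge; apply/negP => /dist1_le0; exact: H.
by move=> p q Kp Kq; apply: (zmin (p, q)); apply/mem_set.
Qed.

(** Only finitely many pairs of cells and pairs (map, vertex) occur, so one constant serves both
    sources of separation. *)
Lemma separation_constant : exists c : R, [/\ 0 < c,
  (forall i j, (forall p q, K p -> K q -> f i p <> f j q) ->
     forall p q, K p -> K q -> c <= dist1 (f i p) (f j q)) &
  (forall j u, ~ fixes r d j u -> c <= 1 - r j - bary_shift r d u j)].
Proof.
have H1 (ij : 'I_N * 'I_N) : exists c, 0 < c /\
    ((forall p q, K p -> K q -> f ij.1 p <> f ij.2 q) ->
     forall p q, K p -> K q -> c <= dist1 (f ij.1 p) (f ij.2 q)).
  have [/disjoint_dist[c [c0 Hc]]|nH] :=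
      pselect (forall p q, K p -> K q -> f ij.1 p <> f ij.2 q).
    by exists c.
  (* When the cells meet the requirement is vacuous, and 1 is a dummy value. *)
  by exists 1.
have [g Hg] := choice H1.
have [c1 [c10 Hc1]] := @finite_pos_lb R _ (fun=> True) g (fun ij _ => (Hg ij).1).
have [c2 [c20 Hc2]] := @finite_pos_lb R _ (fun ju => ~ fixes r d ju.1 ju.2)
  (fun ju => 1 - r ju.1 - bary_shift r d ju.2 ju.1)
  (fun ju => @nfixes_defect _ _ _ _ _ gK ju.1 ju.2).
exists (Num.min c1 c2); split.
- by rewrite lt_min c10.
- move=> i j /(Hg (i, j)).2 H p q Kp Kq; rewrite ge_min.
  by rewrite (le_trans (Hc1 (i, j) I)) //; exact: H.
- by move=> j u nf; rewrite ge_min (Hc2 (j, u)) // orbT.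
Qed.

Lemma phicompSr x n z : phicomp r d x n.+1 z = phicomp r d x n (f (x n) z).
Proof. by elim: n x => // n IH x; rewrite /= -IH. Qed.

Lemma K_phicomp x n p : K p -> K (phicomp r d x n p).
Proof. by elim: n x => //= n IH x Kp; apply: (K_phi gK); exact: IH. Qed.

Lemma phicomp_nested x m n : (n <= m)%N ->
  phicomp r d x m @` K `<=` phicomp r d x n @` K.
Proof.
elim: m => [|m IH]; first by rewrite leqn0 => /eqP ->.
rewrite leq_eqVlt => /orP[/eqP -> //|/IH {}IH] _ [p Kp <-]; apply: IH.
by exists (f (x m) p); [exact: K_phi|rewrite phicompSr].
Qed.

Lemma continuous_phicomp x n : continuous (phicomp r d x n).
Proof.
elim: n x => [|n IH] x z; first exact: cvg_id.
exact: (cvg_comp _ _ (IH (tl x) z) (@continuous_phi (x 0%N) _)).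
Qed.

Lemma dist1_phicomp x n p q :
  dist1 (phicomp r d x n p) (phicomp r d x n q) <= hi ^+ n * dist1 p q.
Proof.
elim: n x => [|n IH] x /=; first by rewrite expr0 mul1r.
rewrite (dist1_phi gK) exprS -mulrA.
by rewrite ler_pM ?dist1_ge0 // ltW // (ratio_gt0 gK).
Qed.

Lemma hi_itv (j : 'I_N) : 0 <= hi < 1.
Proof. by rewrite hi_lt1 andbT ltW // (lt_le_trans (ratio_gt0 gK j)). Qed.

Lemma address_uniq x p q :
  (forall n, (phicomp r d x n @` K) p) -> (forall n, (phicomp r d x n @` K) q) ->
  p = q.
Proof.
move=> Hp Hq; apply/dist1_le0/(le_geometric_le0 (hi_itv (x 0%N))) => n.
have [p' Kp' <-] := Hp n; have [q' Kq' <-] := Hq n.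
apply: le_trans (dist1_phicomp _ _ _ _) _; rewrite [leRHS]mulrC ler_wpM2l //.
  by rewrite exprn_ge0; case/andP: (hi_itv (x 0%N)).
by apply: dist1_Delta; exact: (K_Delta gK).
Qed.

(** The points [phicomp x n p0] have a cluster point in the compact [K]; each closed cell contains a
    tail of them, hence that point, so [xget] does not return its default. *)
Lemma codeP x n : (phicomp r d x n @` K) (code x).
Proof.
suff /xgetPex : exists p, (\bigcap_(n in setT) (phicomp r d x n @` K)) p by apply.
case: (gK) => _ _ _ [[p0 Kp0] cK] _.
pose u n := phicomp r d x n p0.
have uK : (u @ \oo) K by exists 0%N => // k _; exact: K_phicomp.
have [q [_ qcl]] := cK (u @ \oo) _ uK.
exists q => k _.
have /compact_closed cl : compact (phicomp r d x k @` K).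
  apply: continuous_compact => //.
  exact/continuous_subspaceT/continuous_phicomp.
have /closure_id -> : closed (phicomp r d x k @` K).
  by apply: cl; exact: norm_hausdorff.
move: qcl; rewrite clusterE; apply.
by exists k => // l /= kl; apply: phicomp_nested kl _ _; exists p0.
Qed.

Lemma code_uniq x p : (forall n, (phicomp r d x n @` K) p) -> code x = p.
Proof. by apply: address_uniq; exact: codeP. Qed.

Lemma K_code x : K (code x).
Proof. by have [p Kp /= <-] := codeP x 0. Qed.

Lemma Delta_code x : @Delta R (code x).
Proof. exact/(K_Delta gK)/K_code. Qed.

Lemma code_cons x : code x = f (x 0%N) (code (tl x)).
Proof.
apply: code_uniq => -[|n].
  by exists (f (x 0%N) (code (tl x))) => //; apply/(K_phi gK)/K_code.
by have [p Kp <-] := codeP (tl x) n; exists p.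
Qed.

Lemma code_surj p : K p -> exists x, code x = p.
Proof.
have step (z : R * R) : exists jz : 'I_N * (R * R), K z ->
    K jz.2 /\ z = f jz.1 jz.2.
  have [/(K_selfsim gK)[j [q [Kq ->]]]|nK] := pselect (K z).
    by exists (j, q).
  case: (gK) => _ _ _ [[p0 /(K_selfsim gK)[j _]] _] _.
  (* Outside [K] any value will do; a letter is available because [K] is nonempty. *)
  by exists (j, z).
have [g Hg] := choice step => Kp.
pose s n := iter n (fun z => (g z).2) p.
have Ks n : K (s n) by elim: n => // n /Hg[].
exists (fun n => (g (s n)).1); apply: code_uniq => n.
exists (s n) => //; elim: n => // n IH.
by rewrite phicompSr -(Hg (s n) (Ks n)).2.
Qed.

(** * Itineraries and two-sided distance estimates *)

Lemma itin_tl x y k : x 0%N = y 0%N -> it x y k.+1 = it (tl x) (tl y) k.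
Proof.
move=> xy; elim: k => [|k IH]; first by rewrite /= xy eqxx.
by rewrite [LHS]/= -/(it x y k.+1) IH.
Qed.

Lemma itin_Exit x y k :
  delta r d st_Id (x 0%N) (y 0%N) = st_Exit -> it x y k.+1 = st_Exit.
Proof. by move=> E; elim: k => //= k ->. Qed.

(** A state [S u v] only loops or exits, and [Exit] is absorbing, so survival means that all later
    letters fix the prescribed vertices. *)
Lemma itin_S x y k u v : delta r d st_Id (x 0%N) (y 0%N) = st_S u v ->
  it x y k.+1 =
    if `[< forall l, (l < k)%N -> fixes r d (x l.+1) v /\ fixes r d (y l.+1) u >]
    then st_S u v else st_Exit.
Proof.
move=> E; elim: k => [|k IH]; first by rewrite [LHS]E asboolT.
rewrite [LHS]/= -/(it x y k.+1) IH.
case: asboolP => [Hk|nH] /=; last first.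
  by rewrite asboolF // => H; apply: nH => l lk; apply: H; exact: ltnW.
congr (if _ then _ else _); apply/asbool_equiv_eq; split=> [H l|]; last exact.
by rewrite ltnS leq_eqVlt => /orP[/eqP -> //|]; exact: Hk.
Qed.

Lemma code_near_vertex x u k : (forall l, (l < k)%N -> fixes r d (x l) u) ->
  dist1 (code x) (om u) <= 2 * hi ^+ k.
Proof.
elim: k x => [|k IH] x H.
  by rewrite mulr1; apply: dist1_Delta; [exact: Delta_code|exact: Delta_omega].
rewrite code_cons -[X in dist1 _ X](H 0%N) // (dist1_phi gK) exprS mulrCA.
apply: ler_pM; rewrite ?dist1_ge0 ?(ltW (ratio_gt0 gK _)) //.
by apply: IH => l lk; exact: (H l.+1).
Qed.

(** A common first letter contributes a factor [hi]. After a split, both points approach the shared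
    vertex, each within [2 * hi ^+ k], whence the 4. *)
Lemma code_dist_le x y k : it x y k != st_Exit ->
  dist1 (code x) (code y) <= 4 * hi ^+ k.
Proof.
elim: k x y => [|k IH] x y.
  by move=> _; have := dist1_Delta (Delta_code x) (Delta_code y); rewrite expr0; lra.
have [xy|xy] := eqVneq (x 0%N) (y 0%N).
  rewrite itin_tl // => /IH H; rewrite code_cons [code y]code_cons -xy.
  rewrite (dist1_phi gK) exprS mulrCA.
  by apply: ler_pM; rewrite ?dist1_ge0 ?(ltW (ratio_gt0 gK _)).
have [[u [v [uv E /itin_S ->]]]|[/itin_Exit -> _]] := delta_Id gK xy; last by rewrite eqxx.
case: asboolP => // H _.
apply: le_trans (dist1_triangle _ _ (f (x 0%N) (om v))) _.
rewrite code_cons (dist1_phi gK) E [code y]code_cons (dist1_phi gK).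
have Hx := @code_near_vertex (tl x) v k (fun l lk => (H l lk).1).
have Hy := @code_near_vertex (tl y) u k (fun l lk => (H l lk).2).
rewrite dist1C in Hy.
have -> : 4 * hi ^+ k.+1 = hi * (2 * hi ^+ k) + hi * (2 * hi ^+ k) by rewrite exprS; ring.
by rewrite lerD // ler_pM ?dist1_ge0 ?(ltW (ratio_gt0 gK _)).
Qed.

(* [1 - bary u z] plays the role of the distance from [z] to the vertex [u]. *)
Lemma code_far_vertex (c : R) x u k :
    (forall j, ~ fixes r d j u -> c <= 1 - r j - bary_shift r d u j) ->
    ~ fixes r d (x k) u ->
  c * lo ^+ k <= 1 - bary u (code x).
Proof.
move=> Hc; elim: k x => [|k IH] x nf; rewrite code_cons bary_phi.
  rewrite mulr1; apply: le_trans (Hc _ nf) _.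
  have := bary_le1 u (Delta_code (tl x)); have := ratio_gt0 gK (x 0%N).
  by move: (bary _ _) (r _) (bary_shift _ _ _ _) => b t s *; nra.
apply: (@le_trans _ _ (r (x 0%N) * (1 - bary u (code (tl x))))).
  have b1 := bary_le1 u (Delta_code (tl x)).
  have h := IH (tl x) nf.
  rewrite exprS mulrCA; apply: (@le_trans _ _ (lo * (1 - bary u (code (tl x))))).
    by rewrite ler_pM2l.
  by rewrite ler_wpM2r // subr_ge0.
have := bary_shift_le gK u (x 0%N).
by rewrite mulrBr mulr1; lra.
Qed.

(** Common first letters cost a factor of at least [lo] each, which reduces to distinct first
    letters ([base]). Disjoint cells then give [c], and touching ones [c / 2] because of the 2 in
    [touching_dist]. *)
Lemma code_dist_ge : exists c, 0 < c /\ forall x y k, it x y k.+1 = st_Exit ->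
  c * lo ^+ k <= dist1 (code x) (code y).
Proof.
have [c [c0 Hdisj Hvert]] := separation_constant.
have lo1 (j : 'I_N) : lo <= 1 by apply: le_trans (lo_le j) _; rewrite ltW // (ratio_lt1 gK).
have base x y k : x 0%N != y 0%N -> it x y k.+1 = st_Exit ->
    c / 2 * lo ^+ k <= dist1 (code x) (code y).
  move=> xy H; have {lo1} l1 := lo1 (x 0%N).
  have lk1 : lo ^+ k <= 1 by rewrite exprn_ile1 // ltW.
  rewrite (code_cons x) (code_cons y).
  have [[u [v [uv E /itin_S HS]]]|[_ /Hdisj HD]] := delta_Id gK xy; last first.
    apply: le_trans (HD _ _ (K_code _) (K_code _)).
    have : c / 2 * lo ^+ k <= c / 2 by rewrite ler_piMr // divr_ge0 // ltW.
    by move/le_trans; apply; rewrite ler_piMr ?invf_le1 ?ler1n // ltW.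
  move: H; rewrite HS; case: asboolP => // /existsNP[l] /not_implyP[lk] /not_andP nf _.
  (* The offending letter has position [l.+1 <= k], and powers of [lo <= 1] decrease, so exponent
     [l.+1] is good enough. *)
  have lol : lo ^+ k <= lo * lo ^+ l.
    by rewrite -exprS; apply: ler_wiXn2l => //; rewrite ltW.
  have far (w : 'I_3) (z : nat -> 'I_N) D :
      r (z 0%N) * (1 - bary w (code (tl z))) <= 2 * D ->
      ~ fixes r d (z l.+1) w -> c / 2 * lo ^+ k <= D.
    move=> HD nfix; have := @code_far_vertex c (tl z) w l (Hvert^~ w) nfix.
    move=> h; have : lo * (c * lo ^+ l) <= r (z 0%N) * (1 - bary w (code (tl z))).
      by apply: ler_pM => //; rewrite ?mulr_ge0 ?exprn_ge0 // ltW.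
    have : c * lo ^+ k <= c * (lo * lo ^+ l) by rewrite ler_pM2l.
    by rewrite mulrCA; lra.
  have Dx := Delta_code (tl x); have Dy := Delta_code (tl y).
  (* Either a letter of [x] fails to fix [v], and [bary v] separates, or a letter of [y] fails to
     fix [u], and the roles are swapped. *)
  case: nf => nf; first exact: far (touching_dist gK uv E Dx Dy) nf.
  apply: far nf; rewrite dist1C.
  by apply: (touching_dist gK _ (esym E) Dy Dx); rewrite eq_sym.
exists (c / 2); split; first by rewrite divr_gt0.
move=> x y k; elim: k x y => [|k IH] x y H;
    have [xy|/base] := eqVneq (x 0%N) (y 0%N); try exact.
  by move: H; rewrite itin_tl.
rewrite itin_tl // in H; rewrite (code_cons x) (code_cons y) -xy (dist1_phi gK).
rewrite exprS mulrCA; apply: ler_pM => //; last exact: IH.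
  exact: ltW.
by rewrite mulr_ge0 ?exprn_ge0 ?divr_ge0 // ltW.
Qed.

End Coding.

(** * Surviving times, the exponent [s], and the bi-Hölder estimate *)

Lemma rhoM_cases (R : realType) (N : nat) (r : 'I_N -> R) (d : 'I_N -> R * R)
    (xi : R) (x y : nat -> 'I_N) :
  (rhoM r d xi x y = 0 /\ forall k, itin r d x y k != st_Exit) \/
  (exists T, [/\ rhoM r d xi x y = xi ^+ T, itin r d x y T != st_Exit &
                 itin r d x y T.+1 = st_Exit]).
Proof.
rewrite /rhoM; case: pselect => [h|nh]; last first.
  by left; split=> // k; apply/negP => hk; apply: nh; exists k.
(* The first exit time is positive because the itinerary starts at [Id]; its predecessor is the
   surviving time [T]. *)
right; case: ex_minnP => -[//|T] /eqP HT Hmin; exists T; split=> //.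
by apply/negP => /Hmin; rewrite ltnn.
Qed.

Lemma holder_exponent_gt0 (R : realType) (a b : R) :
  0 < a < 1 -> 0 < b < 1 -> 0 < Num.sqrt (ln b / ln a).
Proof. by move=> /ln_lt0 la /ln_lt0 lb; rewrite sqrtr_gt0 nmulr_lgt0 ?invr_lt0. Qed.

(** Since [s * s = ln b / ln a], raising [a] to [s * s] gives [b], while [s * s^-1 = 1] gives back
    [a]. *)
Lemma powR_holder_exponent (R : realType) (a b : R) (T : nat) :
    0 < a < 1 -> 0 < b < 1 ->
  let s := Num.sqrt (ln b / ln a) in
  ((a `^ s) ^+ T) `^ s = b ^+ T /\ ((a `^ s) ^+ T) `^ s^-1 = a ^+ T.
Proof.
move=> Ha Hb s; have s0 : 0 < s := holder_exponent_gt0 Ha Hb.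
have ss : s * s = ln b / ln a.
  by rewrite -expr2 sqr_sqrtr // ltW // -sqrtr_gt0.
have la := ln_lt0 Ha.
case/andP: Ha => a0 _; case/andP: Hb => b0 _.
have sw t : ((a `^ s) ^+ T) `^ t = (a `^ (s * t)) ^+ T.
  have u0 : 0 <= a `^ s := powR_ge0 _ _.
  rewrite powRrM; move: (a `^ s) u0 => u u0.
  by rewrite -(powR_mulrn T u0) -powRrM mulrC powRrM powR_mulrn ?powR_ge0.
rewrite !sw divff ?gt_eqF // powRr1 ?ltW //; split=> //; congr (_ ^+ _).
by rewrite ss /powR gt_eqF // divfK ?lt_eqF // lnK.
Qed.

Unset Implicit Arguments.

Theorem theorem1p3 (R : realType) (N : nat) (r : 'I_N -> R) (d : 'I_N -> R * R)
  (K : set (R * R)) (rmin rmax : R) :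
  gasket r d K ->
  (exists j, r j = rmin) -> (forall j, rmin <= r j) ->
  (exists j, r j = rmax) -> (forall j, r j <= rmax) ->
  let s := Num.sqrt (ln rmax / ln rmin) in
  let xi := rmin `^ s in
  [/\ (forall x, K (piK r d K x)),
      (forall x y, simM r d xi x y -> piK r d K x = piK r d K y),
      (forall x y, piK r d K x = piK r d K y -> simM r d xi x y),
      (forall p, K p -> exists x, piK r d K x = p) &
      exists C : R, 0 < C /\ forall x y,
        C^-1 * (rhoT r d xi x y) `^ (s^-1) <= eucl_dist (piK r d K x) (piK r d K y)
        <= C * (rhoT r d xi x y) `^ s].
Proof.
move=> gK [j1 jmin] lo_le [j2 jmax] le_hi s xi.
have lo_itv : 0 < rmin < 1 by rewrite -jmin (ratio_gt0 gK) (ratio_lt1 gK).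
have hi_itv : 0 < rmax < 1 by rewrite -jmax (ratio_gt0 gK) (ratio_lt1 gK).
have s0 : 0 < s := holder_exponent_gt0 lo_itv hi_itv.
have /andP[lo0 _] := lo_itv; have /andP[hi0 hi1] := hi_itv.
have xi0 : 0 < xi by exact: powR_gt0.
have xiX T : (xi ^+ T) `^ s = rmax ^+ T /\ (xi ^+ T) `^ s^-1 = rmin ^+ T.
  exact: powR_holder_exponent.
have [c [c0 Hc]] := code_dist_ge gK lo0 hi1 lo_le le_hi.
have Hle x y k := @code_dist_le _ _ _ _ _ _ gK hi1 le_hi x y k.
pose D x y := dist1 (piK r d K x) (piK r d K y).
have alive_eq x y : (forall k, itin r d x y k != st_Exit) -> piK r d K x = piK r d K y.
  move=> H; apply: dist1_le0; apply: (@le_geometric_le0 _ _ 4 rmax).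
    by rewrite hi1 ltW.
  by move=> k; exact: Hle.
have eq_alive x y : piK r d K x = piK r d K y -> forall k, itin r d x y k != st_Exit.
  move=> E [//|k]; apply/eqP => /Hc; rewrite E.
  rewrite /dist1 !subrr normr0 addr0 leNgt mulr_gt0 ?exprn_gt0 //.
have sim_code x y : simM r d xi x y -> piK r d K x = piK r d K y.
  rewrite /simM; have [[_ /alive_eq]|[T [-> _ _]]] := rhoM_cases r d xi x y => //.
  by move/eqP; rewrite expf_eq0 (gt_eqF xi0) andbF.
have code_sim x y : piK r d K x = piK r d K y -> simM r d xi x y.
  move=> /eq_alive H; have [[]|[T [_ _ HT]]] := rhoM_cases r d xi x y => //.
  by have := H T.+1; rewrite HT eqxx.
have rho_ge0 x y : 0 <= rhoM r d xi x y.
  have [[-> _]|[T [-> _ _]]] := rhoM_cases r d xi x y => //.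
  by rewrite exprn_ge0 // ltW.
have upper x y : D x y <= 4 * rhoM r d xi x y `^ s.
  have [[-> /alive_eq E]|[T [-> HT _]]] := rhoM_cases r d xi x y.
    by rewrite /D E /dist1 !subrr normr0 addr0 mulr_ge0 ?powR_ge0.
  by rewrite (xiX T).1; exact: Hle.
have lower x y : c * rhoM r d xi x y `^ s^-1 <= D x y.
  have [[-> _]|[T [-> _ HT]]] := rhoM_cases r d xi x y.
    (* [powR] sends 0 to 0 only for a nonzero exponent, hence the appeal to [s != 0]. *)
    by rewrite powR0 ?invr_eq0 ?gt_eqF // mulr0 dist1_ge0.
  by rewrite (xiX T).2; exact: Hc.
have powK t : 0 <= t -> (t `^ s) `^ s^-1 = t.
  by move=> t0; rewrite -powRrM divff ?gt_eqF // powRr1.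
have powKV t : 0 <= t -> (t `^ s^-1) `^ s = t.
  by move=> t0; rewrite -powRrM mulVf ?gt_eqF // powRr1.
have sV0 : 0 <= s^-1 by rewrite invr_ge0 ltW.
have rhoT_le x y : rhoT r d xi x y <= rhoM r d xi x y.
  apply: ge_inf; first by exists 0 => _ [a [b [_ _ ->]]].
  by exists x, y; split=> //; exact: code_sim.
(* The distance [D] does not depend on the representatives, so [upper], solved for [rhoM], bounds
   every member of the set and passes to the infimum. *)
have rhoT_ge x y : (D x y / 4) `^ s^-1 <= rhoT r d xi x y.
  apply: lb_le_inf.
    by exists (rhoM r d xi x y), x, y; split=> //; exact: code_sim.
  move=> _ [a [b [/sim_code Ex /sim_code Ey ->]]].
  rewrite -[leRHS]powK // ge0_ler_powR ?nnegrE ?divr_ge0 ?dist1_ge0 ?powR_ge0 //.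
  by rewrite ler_pdivrMr // mulrC /D Ex Ey; exact: upper.
have rhoT_ge0 x y : 0 <= rhoT r d xi x y.
  by apply: le_trans (rhoT_ge x y); exact: powR_ge0.
split=> //; first by move=> x; exact: (K_code gK).
  exact: (code_surj gK hi1 le_hi).
(* The 4 is the constant of [upper]; [2 * c^-1] comes from [lower] and [dist1 <= 2 * eucl_dist]. *)
exists (4 + 2 * c^-1); have cV0 : 0 < c^-1 by rewrite invr_gt0.
split=> [|x y]; first by lra.
have De := dist1_le_eucl (piK r d K x) (piK r d K y).
have eD := eucl_le_dist1 (piK r d K x) (piK r d K y).
apply/andP; split.
  rewrite ler_pdivrMl; last by lra.
  have H : c * rhoT r d xi x y `^ s^-1 <= D x y.
    apply: le_trans (lower x y); rewrite ler_pM2l //.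
    by rewrite ge0_ler_powR ?nnegrE.
  have {}H : rhoT r d xi x y `^ s^-1 <= c^-1 * (2 * eucl_dist (piK r d K x) (piK r d K y)).
    by rewrite ler_pdivlMl //; exact: le_trans De.
  apply: le_trans H _.
  have e0 : 0 <= eucl_dist (piK r d K x) (piK r d K y) by exact: sqrtr_ge0.
  by rewrite mulrA ler_wpM2r //; lra.
apply: le_trans eD _.
have H : D x y / 4 <= rhoT r d xi x y `^ s.
  rewrite -[leLHS]powKV ?divr_ge0 ?dist1_ge0 //.
  by rewrite ge0_ler_powR ?nnegrE ?powR_ge0 // ltW.
have p0 := powR_ge0 (rhoT r d xi x y) s.
apply: (@le_trans _ _ (4 * rhoT r d xi x y `^ s)).
  by rewrite -ler_pdivrMl // mulrC.
by rewrite ler_wpM2r //; lra.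
Qed.
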